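(* Let $P_4$ denote the path with $4$ edges. If $n$ is divisible by $8$, then $\mathrm{ex}^*(n,P_4)=2n$. In general, $\mathrm{ex}^*(n,P_4)=2n+O(1)$.
   Context: $\mathrm{ex}^*(n,F)$ (the rainbow Turán number) is the maximum number of edges in an $n$-vertex graph that admits a proper edge-coloring containing no rainbow copy of $F$, i.e. no copy of $F$ all of whose edges receive different colors. *)

(* Defs.v *)
From HB Require Import structures.
From mathcomp Require Import all_boot.
From mathcomp Require Import boolp.

Set Implicit Arguments.
Unset Strict Implicit.
Unset Printing Implicit Defensive.

(* Finite simple graphs on the vertex type T, given by their edge sets. *)
Record sgraph (T : finType) := SGraph {
  edges : {set {set T}};
  _ : [forall e in edges, #|e| == 2]
}.

HB.instance Definition _ (T : finType) := [isSub for @edges T].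
HB.instance Definition _ (T : finType) := [Finite of sgraph T by <:].

(* Only the values of c on the edges of G matter. *)
Definition proper_edge_coloring (T : finType) (G : sgraph T)
    (c : {set T} -> nat) : Prop :=
  forall e1 e2 : {set T}, e1 \in edges G -> e2 \in edges G ->
    e1 != e2 -> e1 :&: e2 != set0 -> c e1 != c e2.

(* Copies are not required to be induced. *)
Definition is_copy (U T : finType) (F : sgraph U) (G : sgraph T)
    (f : U -> T) : Prop :=
  injective f /\ forall e : {set U}, e \in edges F -> f @: e \in edges G.

Definition rainbow (U T : finType) (F : sgraph U) (c : {set T} -> nat)
    (f : U -> T) : Prop :=
  {in edges F &, injective (fun e : {set U} => c (f @: e))}.

Definition rainbow_free_colorable (U T : finType) (F : sgraph U)
    (G : sgraph T) : Prop :=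
  exists c : {set T} -> nat,
    proper_edge_coloring G c /\
    ~ exists f : U -> T, is_copy F G f /\ rainbow F c f.

(* If no graph on n vertices qualifies (e.g. F has no edge and at most n
   vertices), the maximum over the empty family is 0. *)
Definition ex_star (n : nat) (U : finType) (F : sgraph U) : nat :=
  \max_(G : sgraph 'I_n | `[< rainbow_free_colorable F G >]) #|edges G|.

(* The edges of the path are {i, i+1} for i < k. *)
Definition path_edges (k : nat) : {set {set 'I_k.+1}} :=
  [set [set widen_ord (leqnSn k) i; lift ord0 i] | i : 'I_k].

Lemma path_edges_simple (k : nat) :
  [forall e in path_edges k, #|e| == 2].
Proof.
apply/forall_inP => _ /imsetP[i _ ->]; rewrite cards2.
by rewrite -val_eqE /= /bump leq0n add1n neq_ltn ltnSn.
Qed.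

(* The path with k edges, hence k+1 vertices. *)
Definition path_graph (k : nat) : sgraph 'I_k.+1 :=
  SGraph (path_edges_simple k).

(* Main.v *)
(* Lower bound: colour K_{4,4} by the Klein four-group, the edge xy getting x + y.
   The four colours sum to 0, so a rainbow walk with 4 edges returns to its
   start.

   Upper bound: by induction on |S|, at most 2|S| edges lie inside a vertex set S.
   Vertices of degree at most 2 can be deleted, and if all degrees are at most 4
   there is nothing to do, so let v have degree d >= 5. A vertex at distance 2
   from v starts a rainbow path that goes through v and ends in a free neighbour
   of v. Otherwise N[v] is a union of components, and a rainbow path i j k v l
   inside N[v] can be found unless N(v) spans at most d + 2 edges. *)

Require Import Defs.
From mathcomp Require Import all_boot.
From mathcomp Require Import boolp zify.

Set Implicit Arguments.
Unset Strict Implicit.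
Unset Printing Implicit Defensive.

(** * Adjacency, edge counting and rainbow paths given by five vertices *)

Definition adj (T : finType) (G : sgraph T) : rel T :=
  fun x y => [set x; y] \in edges G.

Definition has_rainbow_P4 (T : finType) (e : rel T) (c : {set T} -> nat) :=
  exists x0 x1 x2 x3 x4 : T,
    [/\ uniq [:: x0; x1; x2; x3; x4], [/\ e x0 x1, e x1 x2, e x2 x3 & e x3 x4]
      & uniq [:: c [set x0; x1]; c [set x1; x2]; c [set x2; x3]; c [set x3; x4]]].

Lemma adj_sym (T : finType) (G : sgraph T) : symmetric (adj G).
Proof. by move=> x y; rewrite /adj setUC. Qed.

Lemma adj_irr (T : finType) (G : sgraph T) : irreflexive (adj G).
Proof.
move=> x; rewrite /adj setUid; apply/negP => xG.
by have /forall_inP /(_ _ xG) := valP G; rewrite cards1.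
Qed.

Lemma edgeP (T : finType) (G : sgraph T) (e : {set T}) :
  e \in edges G -> exists x y, e = [set x; y] /\ x != y.
Proof.
move=> eG; have /forall_inP /(_ _ eG) /cards2P[x [y [xy ->]]] := valP G.
by exists x, y.
Qed.

Lemma sum_adj_edges (T : finType) (G : sgraph T) :
  \sum_x \sum_y adj G x y = 2 * #|edges G|.
Proof.
transitivity (\sum_(e in edges G) #|e|); last first.
  have card2 e : e \in edges G -> #|e| = 2.
    by move=> eG; have /forall_inP /(_ _ eG) /eqP := valP G.
  by rewrite (eq_bigr _ card2) sum_nat_const mulnC.
have card_sum (e : {set T}) : e \in edges G -> #|e| = \sum_x (x \in e).
  by move=> _; rewrite -sum1_card big_mkcond.
rewrite (eq_bigr _ card_sum) {card_sum}.
rewrite [RHS]exchange_big /=; apply: eq_bigr => x _.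
rewrite -!big_mkcond -big_mkcondr /= !sum1_card.
(* For fixed [x], sending [y] to [[set x; y]] matches the neighbours of [x] with the edges
   containing [x]. *)
rewrite -(@card_in_imset _ _ (fun y => [set x; y]) [pred y | adj G x y]).
  apply: eq_card => e; rewrite unfold_in; apply/imsetP/andP.
    by case=> y; rewrite inE => xy ->; rewrite !inE eqxx.
  case=> eG; have [a [b [eab ab]]] := edgeP eG.
  rewrite eab !inE => /orP[]/eqP xE; rewrite xE.
    by exists b => //; rewrite inE /adj -eab.
  by exists a; rewrite ?inE /adj setUC // -eab.
move=> y z; rewrite !inE => xy xz /setP E.
have := E y; rewrite !inE eqxx orbT => /esym/orP[]/eqP // yx.
by move: xy; rewrite yx adj_irr.
Qed.

(** Replaces embeddings of the path by five explicit vertices, the form in which all paths below are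
    built and excluded. *)
Lemma rainbow_P4E (T : finType) (G : sgraph T) (c : {set T} -> nat) :
  (exists f, is_copy (path_graph 4) G f /\ rainbow (path_graph 4) c f) <->
  has_rainbow_P4 (adj G) c.
Proof.
pose ed (i : 'I_4) : {set 'I_5} := [set widen_ord (leqnSn 4) i; lift ord0 i].
have edE i : ed i \in edges (path_graph 4) by apply: imset_f.
split.
  case=> f [[finj fe] fr].
  pose x k := f (inord k).
  have im i : f @: ed i = [set x i; x i.+1].
    rewrite imsetU1 imset_set1 /x; congr [set f _; f _]; apply: val_inj => /=.
      by rewrite inordK // ltnW // ltnS ltn_ord.
    by rewrite inordK // ltnS.
  have adjx i : i < 4 -> adj G (x i) (x i.+1).
    by move=> i4; have := fe _ (edE (Ordinal i4)); rewrite im.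
  exists (x 0), (x 1), (x 2), (x 3), (x 4); split; last 1 first.
  - pose g k := c [set x k; x k.+1].
    change (uniq (map g (iota 0 4))); rewrite map_inj_in_uniq ?iota_uniq //.
    move=> i j; rewrite !mem_iota !add0n => i4 j4.
    have := fr _ _ (edE (Ordinal i4)) (edE (Ordinal j4)); rewrite !im /= => H gij.
    (* Both i and i + 1 lie in {j, j + 1}, which forces i = j. *)
    have /setP := H gij => /(_ (inord i)) /esym.
    have /setP := H gij => /(_ (inord i.+1)).
    rewrite !inE -!val_eqE /= /bump !inordK //; lia.
  - change (uniq (map x (iota 0 5))); rewrite map_inj_in_uniq ?iota_uniq //.
    move=> i j; rewrite !mem_iota !add0n => i4 j4 /finj /(congr1 val).
    by rewrite /= !inordK.
  by split; apply: adjx.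
case=> x0 [x1 [x2 [x3 [x4 [ux [e0 e1 e2 e3] uc]]]]].
pose s := [:: x0; x1; x2; x3; x4].
pose f (i : 'I_5) := nth x0 s i.
have im (i : 'I_4) : f @: ed i = [set nth x0 s i; nth x0 s i.+1].
  by rewrite imsetU1 imset_set1.
exists f; split; first split.
- by move=> i j /eqP; rewrite nth_uniq // => /eqP/val_inj.
- by move=> _ /imsetP[[[|[|[|[|]]]] // ?] _ ->]; rewrite im.
move=> _ _ /imsetP[i _ ->] /imsetP[j _ ->].
rewrite -!/(ed _) !im => E; congr ed; apply: val_inj.
move/(uniqP 0): uc; apply; rewrite ?inE ?ltn_ord //; move: E.
by case: i j => [[|[|[|[|]]]] // ?] [[|[|[|[|]]]] // ?].
Qed.

(** * Degree sums over vertex sets *)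

(** Pairs are ordered: for symmetric irreflexive [e], [degsum e A A] is twice the number of edges
    inside [A]. All bounds below are therefore doubled. *)
Definition degsum (T : finType) (e : rel T) (A B : {set T}) : nat :=
  \sum_(x in A) \sum_(y in B) e x y.

Lemma degsum_sym (T : finType) (e : rel T) (A B : {set T}) :
  symmetric e -> degsum e A B = degsum e B A.
Proof.
move=> es; rewrite /degsum exchange_big; apply: eq_bigr => x _.
by apply: eq_bigr => y _; rewrite es.
Qed.

Lemma sum_setU (T : finType) (A B : {set T}) (F : T -> nat) :
  [disjoint A & B] ->
  \sum_(x in A :|: B) F x = \sum_(x in A) F x + \sum_(x in B) F x.
Proof. by move=> dAB; rewrite -bigU //; apply: eq_bigl => x; rewrite !inE. Qed.

Lemma degsumU (T : finType) (e : rel T) (A B : {set T}) :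
  symmetric e -> [disjoint A & B] ->
  degsum e (A :|: B) (A :|: B) =
    degsum e A A + degsum e B B + 2 * degsum e A B.
Proof.
move=> es dAB; rewrite {1}/degsum sum_setU //.
have splitU (C : {set T}) : \sum_(x in C) \sum_(y in A :|: B) e x y
    = degsum e C A + degsum e C B.
  by rewrite -big_split; apply: eq_bigr => x _; rewrite sum_setU.
by rewrite !splitU (degsum_sym B A es); lia.
Qed.

Lemma degsum1l (T : finType) (e : rel T) (x : T) (A : {set T}) :
  degsum e [set x] A = #|[set y in A | e x y]|.
Proof.
rewrite /degsum big_set1 -sum1_card -big_mkcondr.
by apply: eq_bigl => y; rewrite inE.
Qed.

Lemma degsum_card (T : finType) (e : rel T) (A B : {set T}) :
  degsum e A B = \sum_(x in A) #|[set y in B | e x y]|.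
Proof. by apply: eq_bigr => x _; rewrite -degsum1l /degsum big_set1. Qed.

Lemma degsumD1 (T : finType) (e : rel T) (A : {set T}) (x : T) :
  symmetric e -> irreflexive e -> x \in A ->
  degsum e A A =
    degsum e (A :\ x) (A :\ x) + 2 * #|[set y in A | e x y]|.
Proof.
move=> es ei xA; rewrite -{1 2}(setD1K xA) degsumU //; last first.
  by rewrite disjoints1 !inE eqxx.
have exx : #|[set y in [set x] | e x y]| = 0.
  by apply: eq_card0 => y; rewrite !inE; case: eqP => // ->; rewrite ei.
rewrite !degsum1l exx add0n. congr (_ + 2 * _).
by apply: eq_card => y; rewrite !inE; case: eqP => // ->; rewrite ei !andbF.
Qed.

(** Deleting a vertex changes the sum by an even amount. This parity later improves a bound of 15 to
    14. *)
Lemma degsum_even (T : finType) (e : rel T) (A : {set T}) :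
  symmetric e -> irreflexive e -> ~~ odd (degsum e A A).
Proof.
move=> es ei; have [n] := ubnP #|A|; elim: n A => // n IH A leAn.
have [->|[x xA]] := set_0Vmem A; first by rewrite /degsum big_set0.
rewrite (degsumD1 es ei xA) oddD oddM /= addbF IH //.
by move: leAn; rewrite (cardsD1 x A) xA.
Qed.

(** Pigeonhole: as [c] is injective on [A], each vertex in [s] and each colour in [t] rules out at
    most one element of [A]. *)
Lemma exists_avoiding (T : finType) (U : eqType) (c : T -> U) (A : {set T})
    (s : seq T) (t : seq U) :
  {in A &, injective c} -> size s + size t < #|A| ->
  exists x, [/\ x \in A, x \notin s & c x \notin t].
Proof.
move=> cinj; rewrite ltnNge => /negP lt_st.
apply: contrapT => none; apply: lt_st.
have st x : x \in A -> x \notin s -> c x \in t.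
  move=> xA xs; apply: contrapT => xt; apply: none.
  by exists x; split => //; apply/negP.
(* If every element were ruled out, [g] would inject [A] into the disjoint union of [s] and [t]. *)
pose g x : T + U := if x \in s then inl x else inr (c x).
rewrite cardE -(size_map g) -(size_map (inl : T -> T + U) s)
  -(size_map (inr : U -> T + U) t) -size_cat.
apply: uniq_leq_size.
  rewrite map_inj_in_uniq ?enum_uniq // => x y; rewrite !mem_enum => xA yA.
  by rewrite /g; case: ifP; case: ifP => // _ _ [] //; apply: cinj.
move=> z /mapP[x]; rewrite mem_enum => xA ->; rewrite mem_cat /g.
by case: ifPn => xs; apply/orP; [left|right]; apply: map_f => //; apply: st.
Qed.

Definition proper_on (T : finType) (e : rel T) (c : {set T} -> nat) :=
  forall x y z, e x y -> e x z -> y != z -> c [set x; y] != c [set x; z].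

Ltac uniq_tac := rewrite /= ?inE ?negb_or; repeat (apply/andP; split);
  first [done | assumption | by rewrite eq_sym; assumption].

(** Compares the counts of an arbitrary predicate on both sequences; each truth value becomes an
    arbitrary number, leaving a linear identity. *)
Ltac perm_tac := apply/permP => P /=; clear;
  repeat (match goal with |- context [nat_of_bool ?b] =>
    generalize (nat_of_bool b); intro end); lia.

(** * Upper bound: rainbow paths through a vertex of large degree *)

Section Upper.
Variables (T : finType) (e : rel T) (c : {set T} -> nat).
Hypotheses (es : symmetric e) (ei : irreflexive e).
Hypotheses (cp : proper_on e c) (noP : ~ has_rainbow_P4 e c).

Let col x y := c [set x; y].
Let colC x y : col x y = col y x.
Proof. by rewrite /col setUC. Qed.

Lemma edge_neq x y : e x y -> x != y.
Proof. by apply: contraTneq => ->; rewrite ei. Qed.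

Lemma star_inj v (A : {set T}) :
  {in A, forall x, e v x} -> {in A &, injective (col v)}.
Proof.
move=> vA x y xA yA exy; apply/eqP; apply: contrapT => /negP xy.
by have := cp (vA _ xA) (vA _ yA) xy; rewrite /col in exy; rewrite exy eqxx.
Qed.

(** The path is a' a u v l. Choosing a' next to a excludes u and the colour of uv, two exclusions
    against three neighbours. Choosing l in [A] excludes u, a' and the colours of ua and aa', four
    against five. Consecutive edges differ by properness, and non-adjacency of a and v keeps a' off
    v and l off a. *)
Lemma dist2_P4 v u a (A : {set T}) :
  {in A, forall x, e v x} -> u \in A -> e u a -> ~~ e a v -> a != v ->
  3 <= #|[set y | e a y]| -> 5 <= #|A| -> False.
Proof.
move=> vA uA ua nav av degA cA; apply: noP.
have vu := vA _ uA.
have [||a' []] := @exists_avoiding T nat (col a) [set y | e a y] [:: u] [:: col u v].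
- by apply: star_inj => x; rewrite inE.
- by [].
rewrite !inE => aa' a'u colaa'.
have [||l []] := @exists_avoiding T nat (col v) A [:: u; a'] [:: col u a; col a a'].
- exact: star_inj.
- by [].
rewrite !inE !negb_or => lA /andP[lu la'] /andP[cl1 cl2].
have vl := vA _ lA.
have a'v : a' != v by apply: contraNneq nav => <-.
have al : a != l by apply: contraNneq nav => ->; rewrite es.
have := (edge_neq vu, edge_neq vl, edge_neq aa', edge_neq ua).
move=> [[[? ?] ?] ?].
have uv : e u v by rewrite es.
have au : e a u by rewrite es.
have := cp au aa'; rewrite eq_sym a'u => /(_ isT) c1.
have := cp ua uv av => c2.
have := cp vu vl; rewrite eq_sym lu => /(_ isT) c3.
exists a', a, u, v, l; split.
- uniq_tac.
- by split => //; rewrite es.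
rewrite -!/(col _ _) in c1 c2 c3 *.
rewrite (colC a' a) (colC a u); rewrite (colC a u) (colC v u) in c1 c3.
uniq_tac.
Qed.

(* Otherwise i j k v l is a rainbow path. *)
Lemma cherry v i j k l :
  e v k -> e v l -> e i j -> e j k -> uniq [:: v; i; j; k; l] ->
  col i j != col v k -> col v l != col i j -> col v l = col j k.
Proof.
move=> vk vl ij jk; rewrite /= !inE !negb_or -!andbA.
case/and5P => vi vj nvk nvl /and5P[nij ik il njk /and3P[jl kl _]] cij clij.
apply/eqP; apply: contrapT => /negP cl; apply: noP.
have ji : e j i by rewrite es.
have kj : e k j by rewrite es.
have kv : e k v by rewrite es.
have jv : j != v by rewrite eq_sym.
have := (cp ji jk ik, cp vk vl kl, cp kj kv jv).
rewrite -!/(col _ _) => -[[c1 c2] c3].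
rewrite (colC j i) in c1; rewrite (colC k j) (colC k v) in c3.
exists i, j, k, v, l; split.
- uniq_tac.
- by [].
rewrite -!/(col _ _) (colC k v); uniq_tac.
Qed.

(** Given three neighbours of j in [A], two of them serve as i and k with vk not coloured like ij.
    Then l must avoid i, j, k and the colours of ij and jk, five exclusions against six elements,
    and i j k v l contradicts [cherry]. *)
Lemma deg_nbhd_ge6 v (A : {set T}) :
  {in A, forall x, e v x} -> 6 <= #|A| ->
  {in A, forall j, #|[set y in A | e j y]| <= 2}.
Proof.
move=> vA cA j jA; rewrite leqNgt; apply/negP => deg3.
have cinj := star_inj vA.
have pick3 (s : seq T) t : size s + size t <= 2 ->
    exists x, [/\ x \in A, e j x, x \notin s & col v x \notin t].
  move=> st; have [||x []] := @exists_avoiding T nat (col v) [set y in A | e j y] s t.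
  - by apply: star_inj => x; rewrite inE => /andP[/vA].
  - exact: leq_ltn_trans deg3.
  by rewrite inE => /andP[? ?] ? ?; exists x.
have [i [iA ji _ _]] := pick3 [::] [::] isT.
have [k [kA jk]] := pick3 [:: i] [:: col i j] isT.
rewrite !inE eq_sym => ik; rewrite eq_sym => ck.
have [||l []] := @exists_avoiding T nat (col v) A [:: i; j; k] [:: col i j; col j k].
- exact: star_inj.
- by [].
rewrite !inE !negb_or => lA /and3P[li lj lk] /andP[cl1 cl2].
have := @cherry v i j k l (vA _ kA) (vA _ lA).
rewrite es => /(_ ji jk) H; move: cl2; rewrite H ?eqxx //.
have := (edge_neq (vA _ iA), edge_neq (vA _ jA), edge_neq (vA _ kA),
  edge_neq (vA _ lA)) => -[[[? ?] ?] ?].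
have := (edge_neq ji, edge_neq jk) => -[? ?].
uniq_tac.
Qed.

(** * Edges inside a neighbourhood of size five *)

(** By [cherry] along j a d v f and j d a v b, an edge ad would carry both the colour of vf and that
    of vb. *)
Lemma no_cross_edge v j a b d f :
  {in [:: j; a; b; d; f], forall x, e v x} ->
  {in [:: a; b; d; f], forall x, e j x} ->
  uniq [:: j; a; b; d; f] ->
  col j a = col v b -> col j d = col v f -> ~~ e a d.
Proof.
move=> vN jN uN ja jd; apply/negP => ad.
have [va [vb [vd vf]]] : e v a /\ e v b /\ e v d /\ e v f.
  by do !split; apply: vN; rewrite !inE eqxx ?orbT.
have vj : e v j by apply: vN; rewrite !inE eqxx.
have [eja ejd] : e j a /\ e j d by split; apply: jN; rewrite !inE eqxx ?orbT.
have da : e d a by rewrite es.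
have := (edge_neq vj, edge_neq va, edge_neq vb, edge_neq vd, edge_neq vf).
move=> [[[[? ?] ?] ?] ?].
move: (uN); rewrite /= !inE !negb_or -!andbA.
case/and5P => nja njb njd njf /and5P[nab nad naf nbd /and3P[nbf ndf _]].
have adf : col v f = col a d.
  apply: (@cherry v j a d f) => //; rewrite ?ja.
  - uniq_tac.
  - exact: cp.
  - by apply: cp => //; rewrite eq_sym.
have dab : col v b = col d a.
  apply: (@cherry v j d a b) => //; rewrite ?jd.
  - uniq_tac.
  - by apply: cp => //; rewrite eq_sym.
  - exact: cp.
by have := cp vb vf nbf; rewrite -!/(col _ _) adf dab colC eqxx.
Qed.

(** This is [cherry] for the path x j y v z: since v and j are joined to all of [s], only the two
    colour conditions remain to be checked. *)
Lemma cherry_centre v j x y z (s : seq T) :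
  {in j :: s, forall x, e v x} -> {in s, forall x, e j x} -> j \notin s ->
  x \in s -> y \in s -> z \in s -> uniq [:: x; y; z] ->
  col j x != col v y -> col v z != col j x -> col v z = col j y.
Proof.
move=> vN jN js xs ys zs; rewrite /= !inE negb_or -!andbA.
case/and4P => xy xz yz _.
have vs u : u \in s -> e v u by move=> us; apply: vN; rewrite inE us orbT.
have vj : e v j by apply: vN; rewrite inE eqxx.
rewrite [col j x]colC; apply: cherry; rewrite ?vs ?jN //; first by rewrite es jN.
have ns u : u \in s -> j != u by apply: contraTneq => <-.
have := (edge_neq vj, edge_neq (vs _ xs), edge_neq (vs _ ys), edge_neq (vs _ zs),
  ns _ xs, ns _ ys, ns _ zs) => -[[[[[[? ?] ?] ?] ?] ?] ?].
uniq_tac.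
Qed.

(* v and j are adjacent to each other and to all of a, b, d, f; the colours at j
   then pair {a, b} and {d, f}, and no edge joins the two pairs. *)
Lemma degsum_twice_dominated_paired v j a b d f :
  {in [:: j; a; b; d; f], forall x, e v x} ->
  {in [:: a; b; d; f], forall x, e j x} ->
  uniq [:: j; a; b; d; f] -> col j a = col v b ->
  degsum e [set a; b; d; f] [set a; b; d; f] <= 4.
Proof.
move=> vN jN uN ja.
move: (uN); rewrite cons_uniq => /andP[jn uN4].
have C := cherry_centre vN jN jn.
have vab x y : x \in [:: a; b; d; f] -> y \in [:: a; b; d; f] -> x != y ->
    col v x != col v y.
  by move=> xs ys; apply: cp; apply: vN; rewrite inE ?xs ?ys orbT.
have [sa [sb [sd sf]]] : a \in [:: a; b; d; f] /\ b \in [:: a; b; d; f] /\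
    d \in [:: a; b; d; f] /\ f \in [:: a; b; d; f].
  by rewrite !inE !eqxx !orbT.
move: uN4; rewrite /= !inE !negb_or -!andbA.
case/and5P => nab nad naf nbd /and3P[nbf ndf _].
have jd : col j d = col v f.
  apply/esym/(C a d f) => //; rewrite ?ja; [uniq_tac|exact: vab|].
  by rewrite vab // eq_sym.
have jf : col j f = col v d.
  apply/esym/(C a f d) => //; rewrite ?ja; [uniq_tac|exact: vab|].
  by rewrite vab // eq_sym.
have jb : col j b = col v a.
  apply/esym/(C d b a) => //; rewrite ?jd; [uniq_tac| |exact: vab].
  by rewrite vab // eq_sym.
have NC x y z t : perm_eq [:: x; y; z; t] [:: a; b; d; f] ->
    col j x = col v y -> col j z = col v t -> e x z = false.
  move=> p jx jz; apply/negbTE; apply: (@no_cross_edge v j x y z t) => //.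
  - move=> u; rewrite inE (perm_mem p) => us; exact: vN.
  - move=> u; rewrite (perm_mem p); exact: jN.
  - by rewrite cons_uniq (perm_mem p) (perm_uniq p) -cons_uniq.
have ad : e a d = false by apply: (NC a b d f).
have af : e a f = false by apply: (NC a b f d) => //; perm_tac.
have bd : e b d = false by apply: (NC b a d f) => //; perm_tac.
have bf : e b f = false by apply: (NC b a f d) => //; perm_tac.
have setE : [set a; b; d; f] = [set a; b] :|: [set d; f] by rewrite setUA.
(* Each pair spans at most one edge, counted twice; with no edges across, the total is at most 2 +
   2. *)
have pair_le x y : degsum e [set x; y] [set x; y] <= 2.
  have [->|xy] := eqVneq x y.
    by rewrite setUid /degsum !big_set1 ei.
  rewrite /degsum !(big_setU1, big_set1) ?inE //= !ei.
  by case: (e x y); case: (e y x).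
rewrite setE degsumU //; last first.
  rewrite disjoint_sym disjoints_subset; apply/subsetP => x.
  by rewrite !inE => /orP[]/eqP ->; rewrite negb_or ?(eq_sym d) ?(eq_sym f)
    ?nad ?naf ?nbd ?nbf.
rewrite [degsum e [set a; b] [set d; f]](_ : _ = 0).
  by rewrite muln0 addn0 (leq_add (pair_le a b) (pair_le d f)).
by rewrite /degsum !(big_setU1, big_set1) ?inE //= ad af bd bf.
Qed.

(** If ja shares its colour with vb, vd or vf, this is the paired case after renaming. Otherwise the
    paths a j b v d and a j b v f force both vd and vf to have the colour of jb. *)
Lemma degsum_twice_dominated v j a b d f :
  {in [:: j; a; b; d; f], forall x, e v x} ->
  {in [:: a; b; d; f], forall x, e j x} ->
  uniq [:: j; a; b; d; f] ->
  degsum e [set a; b; d; f] [set a; b; d; f] <= 4.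
Proof.
move=> vN jN uN.
have key x y z t : perm_eq [:: x; y; z; t] [:: a; b; d; f] ->
    col j x = col v y -> degsum e [set a; b; d; f] [set a; b; d; f] <= 4.
  move=> p jx; have <- : [set x; y; z; t] = [set a; b; d; f].
    by apply/setP => u; have := perm_mem p u; rewrite !inE -!orbA.
  apply: (@degsum_twice_dominated_paired v j) => //.
  - move=> u; rewrite inE (perm_mem p) => us; exact: vN.
  - move=> u; rewrite (perm_mem p); exact: jN.
  - by rewrite cons_uniq (perm_mem p) (perm_uniq p) -cons_uniq.
have [E|nb] := eqVneq (col j a) (col v b); first exact: key E.
have [E|nd] := eqVneq (col j a) (col v d).
  by apply: (key a d b f) => //; perm_tac.
have [E|nf] := eqVneq (col j a) (col v f).
  by apply: (key a f b d) => //; perm_tac.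
move: (uN); rewrite cons_uniq => /andP[jn uN4].
have C := cherry_centre vN jN jn.
have vd : e v d by apply: vN; rewrite !inE eqxx ?orbT.
have vf : e v f by apply: vN; rewrite !inE eqxx ?orbT.
move: uN4; rewrite /= !inE !negb_or -!andbA.
case/and5P => nab nad naf nbd /and3P[nbf ndf _].
have jd : col v d = col j b.
  by apply: (C a b d); rewrite ?inE ?eqxx ?orbT // 1?eq_sym //; uniq_tac.
have jf : col v f = col j b.
  by apply: (C a b f); rewrite ?inE ?eqxx ?orbT // 1?eq_sym //; uniq_tac.
by have := cp vd vf ndf; rewrite -!/(col _ _) jd jf eqxx.
Qed.

(** If all degrees inside [A] are at most 3, the sum is at most 15, hence at most 14 by parity.
    Otherwise some j is joined to the other four vertices; these contribute at most 4 among
    themselves and j adds 8. *)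
Lemma degsum_nbhd5 v (A : {set T}) :
  {in A, forall x, e v x} -> #|A| = 5 -> degsum e A A <= 14.
Proof.
move=> vA cA.
case: (boolP [exists j in A, 3 < #|[set y in A | e j y]|]) => [|noj]; last first.
  have le15 : degsum e A A <= 15.
    rewrite degsum_card -[15]/(5 * 3) -cA -sum_nat_const.
    apply: leq_sum => j jA; rewrite leqNgt; apply: contra noj => H.
    by apply/existsP; exists j; rewrite jA.
  have := degsum_even A es ei; move: le15.
  by rewrite leq_eqVlt => /orP[/eqP ->|].
case/existsP => j /andP[jA degj].
have cAj : #|A :\ j| = 4 by move: cA; rewrite (cardsD1 j) jA => -[].
have jAj : {in A :\ j, forall x, e j x}.
  move=> x; suff <- : [set y in A | e j y] = A :\ j by rewrite inE => /andP[].
  apply/eqP; rewrite eqEcard cAj degj andbT; apply/subsetP => y.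
  by rewrite !inE => /andP[-> /edge_neq]; rewrite eq_sym => ->.
have degj4 : #|[set y in A | e j y]| <= 4.
  rewrite -cAj; apply/subset_leq_card/subsetP => y.
  by rewrite !inE => /andP[-> /edge_neq]; rewrite eq_sym => ->.
rewrite (degsumD1 es ei jA).
suff : degsum e (A :\ j) (A :\ j) <= 4 by lia.
have : uniq (j :: enum (A :\ j)).
  by rewrite cons_uniq enum_uniq mem_enum !inE eqxx.
have : size (enum (A :\ j)) = 4 by rewrite -cardE.
have memE x : (x \in enum (A :\ j)) = (x \in A :\ j) by rewrite mem_enum.
case: (enum _) memE => [|a [|b [|d [|f [|? ?]]]]] // memE _ u.
have -> : A :\ j = [set a; b; d; f].
  by apply/setP => x; rewrite -memE !inE !orbA.
apply: (@degsum_twice_dominated v j) => [x|x|//].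
- by rewrite inE => /orP[/eqP ->|]; [exact: vA|rewrite memE inE => /andP[_ /vA]].
- by rewrite memE => /jAj.
Qed.

(** * Induction on the vertex set *)

Theorem degsum_le4 (S : {set T}) : degsum e S S <= 4 * #|S|.
Proof.
have [n] := ubnP #|S|; elim: n S => // n IH S leSn.
case: (boolP [exists x in S, #|[set y in S | e x y]| <= 2]) => [|deg3].
  (* Deleting x lowers the doubled count by at most 4, the allowance of one vertex. *)
  case/existsP => x /andP[xS dx]; rewrite (degsumD1 es ei xS).
  have cS := cardsD1 x S; rewrite xS in cS.
  by have := IH (S :\ x); lia.
case: (boolP [exists x in S, 4 < #|[set y in S | e x y]|]) => [|deg4]; last first.
  rewrite degsum_card mulnC -sum_nat_const; apply: leq_sum => x xS.
  rewrite leqNgt; apply: contra deg4 => H.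
  by apply/existsP; exists x; rewrite xS.
case/existsP => v /andP[vS degv].
set A := [set y in S | e v y] in degv.
have vA : {in A, forall x, e v x} by move=> x; rewrite inE => /andP[].
have AS : A \subset S by apply/subsetP => x; rewrite inE => /andP[].
pose K := v |: A.
have vNA : v \notin A by rewrite inE ei andbF.
have KS : K \subset S by rewrite subUset sub1set vS.
have SE : S = K :|: (S :\: K).
  by rewrite setDE setUIr setUCr setIT; apply/esym/setUidPr.
(* A vertex a outside [K] with a neighbour x in [K] is at distance 2 from v, and its degree is at
   least 3 because the first case failed, so [dist2_P4] applies. *)
have cross : degsum e K (S :\: K) = 0.
  rewrite degsum_card big1 // => x xK; apply: eq_card0 => a; rewrite !inE negb_or.
  apply/negP => /andP[/andP[/andP[av]]]; rewrite negb_and => + aS.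
  rewrite aS /= => nva xa.
  move: xK; rewrite !inE => /orP[/eqP xv|/andP[xS vx]].
    by move: nva; rewrite -xv xa.
  have nav : ~~ e a v by rewrite es.
  have xA : x \in A by rewrite inE xS.
  apply: (@dist2_P4 v x a A vA xA xa nav av _ degv).
  apply: leq_trans (_ : #|[set y in S | e a y]| <= _).
    by rewrite ltnNge; apply: contra deg3 => H; apply/existsP; exists a; rewrite aS.
  by apply/subset_leq_card/subsetP => y; rewrite !inE => /andP[].
have KA : degsum e K K = degsum e A A + 2 * #|A|.
  have vK : v \in K by rewrite setU11.
  rewrite (degsumD1 es ei vK) setU1K //; congr (_ + 2 * _).
  apply: eq_card => y; rewrite !inE.
  by case: eqP => [->|_] /=; [rewrite ei andbF|rewrite -andbA andbb].
have cK : #|K| = #|A|.+1 by rewrite cardsU1 vNA.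
(* Exactly what is needed: adding the 2 * #|A| from v gives 4 * #|A| + 4 = 4 * #|K|. For #|A| = 5
   the bound is the 14 found above. *)
have EA : degsum e A A <= 2 * #|A| + 4.
  have [ge6|lt6] := leqP 6 #|A|.
    apply: leq_trans (leq_addr _ _); rewrite mulnC degsum_card -sum_nat_const.
    by apply: leq_sum => x xA; apply: deg_nbhd_ge6 vA ge6 x xA.
  by have := @degsum_nbhd5 v A vA; lia.
have cS : #|S| = #|K| + #|S :\: K|.
  by rewrite [#|S :\: K|]cardsD (setIidPr KS) subnKC ?subset_leq_card.
have dS : degsum e S S = degsum e K K + degsum e (S :\: K) (S :\: K).
  rewrite {1 2}SE degsumU ?cross ?muln0 ?addn0 //.
  by rewrite disjoints_subset; apply/subsetP => y yK; rewrite in_setC in_setD yK.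
by have := IH (S :\: K); lia.
Qed.
End Upper.

Lemma edges_le (T : finType) (G : sgraph T) :
  rainbow_free_colorable (path_graph 4) G -> #|edges G| <= 2 * #|T|.
Proof.
case=> c [cp noP].
have cpa : proper_on (adj G) c.
  move=> x y z xy xz yz; apply: cp => //.
    apply: contra_neq yz => /setP /(_ y); rewrite !inE eqxx orbT => /esym/orP[]/eqP //.
    by move=> yx; move: xy; rewrite yx adj_irr.
  by apply/set0Pn; exists x; rewrite !inE eqxx.
have := @degsum_le4 _ _ c (@adj_sym _ G) (@adj_irr _ G) cpa.
move=> /(_ (fun H => noP ((rainbow_P4E G c).2 H)) setT).
have -> : degsum (adj G) setT setT = 2 * #|edges G|.
  rewrite -sum_adj_edges /degsum (eq_bigl xpredT) => [|x]; last by rewrite inE.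
  by apply: eq_bigr => x _; apply: eq_bigl => y; rewrite inE.
by rewrite cardsT; lia.
Qed.

(** * Lower bound: disjoint copies of $K_{4,4}$ *)

(* Vertex 8 q + r sits in the q-th copy of K_{4,4}; bit 2 of r is its side, bits
   0 and 1 are a label in the Klein four-group. *)
Definition K44_rel (n : nat) : rel 'I_n := fun i j =>
  [&& i %/ 8 == j %/ 8, odd (i %/ 4) != odd (j %/ 4) & i %/ 8 < n %/ 8].

Lemma K44_sym (n : nat) : symmetric (@K44_rel n).
Proof.
move=> i j; rewrite /K44_rel (eq_sym (i %/ 8)) (eq_sym (odd (i %/ 4))).
by case: eqP => // ->.
Qed.

Lemma K44_simple (n : nat) :
  [forall e in [set [set p.1; p.2] | p in [pred p | K44_rel p.1 p.2]]
     : {set {set 'I_n}},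
     #|e| == 2].
Proof.
apply/forall_inP => _ /imsetP[[i j] + ->]; rewrite inE /= => /and3P[_ ij _].
by rewrite cards2; case: (eqVneq i j) ij => [->|]; rewrite ?eqxx.
Qed.

Definition K44s (n : nat) : sgraph 'I_n := SGraph (@K44_simple n).

Lemma adj_K44s (n : nat) (i j : 'I_n) : adj (K44s n) i j = K44_rel i j.
Proof.
apply/imsetP/idP => [[[a b]]|ij]; last by exists (i, j); rewrite ?inE.
rewrite inE /= => ab E.
have := E => /setP /(_ a); rewrite !inE eqxx /= => /orP[]/eqP ai.
  have := E => /setP /(_ b); rewrite !inE eqxx orbT => /orP[]/eqP bi.
    by move: ab; rewrite ai bi /K44_rel !eqxx andbF.
  by rewrite -ai -bi.
have := E => /setP /(_ b); rewrite !inE eqxx orbT => /orP[]/eqP bi.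
  by rewrite -ai -bi K44_sym.
by move: ab; rewrite ai bi /K44_rel !eqxx andbF.
Qed.

(** The group sum of the labels in [e], its two bits read as a number below 4. Summing over the set
    makes it independent of the order of the endpoints. *)
Definition K44_col (n : nat) (e : {set 'I_n}) : nat :=
  \big[addb/false]_(i in e) odd i + 2 * \big[addb/false]_(i in e) odd (i %/ 2).

Lemma K44_colE (n : nat) (i j : 'I_n) : i != j ->
  K44_col [set i; j] = (odd i (+) odd j) + 2 * (odd (i %/ 2) (+) odd (j %/ 2)).
Proof. by move=> ij; rewrite /K44_col !big_setU1 ?inE //= !big_set1. Qed.

(** Copy, side and the two label bits are coordinates of a vertex; properness and rainbow-freeness
    are both proved by comparing them. *)
Lemma bits8 (i j : nat) : i %/ 8 = j %/ 8 -> odd (i %/ 4) = odd (j %/ 4) ->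
  odd (i %/ 2) = odd (j %/ 2) -> odd i = odd j -> i = j.
Proof. lia. Qed.

Lemma K44_irr (n : nat) (i j : 'I_n) : K44_rel i j -> i != j.
Proof. by case/and3P => _ + _; apply: contraNneq => ->. Qed.

Lemma K44_rainbow_free (n : nat) : rainbow_free_colorable (path_graph 4) (K44s n).
Proof.
exists (@K44_col n); split.
  move=> e1 e2 e1G e2G + /set0Pn[x]; rewrite inE => + /andP[].
  have ex e : e \in edges (K44s n) -> x \in e ->
      exists2 y, e = [set x; y] & K44_rel x y.
    move=> eG; have [a [b [eab _]]] := edgeP eG.
    move: eG; rewrite eab -/(adj _ _ _) adj_K44s !inE => ab /orP[]/eqP ->.
      by exists b.
    by exists a; rewrite 1?setUC // K44_sym.
  move=> + /(ex _ e1G)[y e1E xy] /(ex _ e2G)[z e2E xz].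
  rewrite {}e1E {}e2E; apply: contra_neq; rewrite !K44_colE ?K44_irr //.
  have [/and3P[/eqP b1 /eqP s1 _] /and3P[/eqP b2 /eqP s2 _]] := (xy, xz).
  move=> E; suff -> : y = z by [].
  apply/val_inj/bits8; rewrite -?b1 -?b2 //=.
  - by move: s1 s2; do 3 case: (odd (_ %/ 4)).
  - by move: E; do 3 case: (odd (_ %/ 2)); do 3 case: (odd _).
  - by move: E; do 3 case: (odd (_ %/ 2)); do 3 case: (odd _).
case/rainbow_P4E => x0 [x1 [x2 [x3 [x4 [ux [e0 e1 e2 e3]]]]]].
have x04 : x0 != x4 by move: ux; rewrite /= !inE !negb_or => /andP[/and4P[]].
move: e0 e1 e2 e3; rewrite !adj_K44s => e0 e1 e2 e3.
rewrite !K44_colE ?K44_irr //.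
move: e0 e1 e2 e3 => /and3P[/eqP b0 s0 _] /and3P[/eqP b1 s1 _].
move=> /and3P[/eqP b2 s2 _] /and3P[/eqP b3 s3 _].
(* [x0] and [x4] agree in every coordinate: the copy never changes, the side flips four times, and a
   check of truth values shows that four distinct colours cancel in both label bits. *)
move=> U; move/negP: x04; apply; apply/eqP/val_inj/bits8 => /=.
- by rewrite b0 b1 b2.
- by move: s0 s1 s2 s3; do 5 case: (odd (_ %/ 4)).
- by move: U; do 5 case: (odd (_ %/ 2)); do 5 case: (odd _).
- by move: U; do 5 case: (odd (_ %/ 2)); do 5 case: (odd _).
Qed.

(** Each vertex of a complete block of 8 has four neighbours, and the degrees sum to twice the
    number of edges. Vertices beyond the last complete block contribute nothing. *)
Lemma edges_K44s (n : nat) : 16 * (n %/ 8) <= #|edges (K44s n)|.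
Proof.
suff : 4 * (8 * (n %/ 8)) <= 2 * #|edges (K44s n)| by lia.
rewrite -sum_adj_edges.
pose A := [set i : 'I_n | i %/ 8 < n %/ 8].
have cA : 8 * (n %/ 8) <= #|A|.
  have lt8 : 8 * (n %/ 8) <= n by lia.
  have winj : injective (widen_ord lt8) by move=> i j [] /val_inj.
  rewrite -[X in X <= _]card_ord -(card_imset _ winj).
  apply/subset_leq_card/subsetP => _ /imsetP[i _ ->]; rewrite inE /=.
  by have := ltn_ord i; lia.
rewrite (bigID (mem A)) /=; apply: leq_trans (leq_addr _ _).
apply: leq_trans (_ : #|A| * 4 <= _); first by lia.
rewrite -sum_nat_const; apply: leq_sum => i; rewrite inE => iA.
rewrite -big_mkcond sum1_card.
(* The four vertices on the opposite side of the block of [i]. *)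
have nb (k : 'I_4) : 8 * (i %/ 8) + 4 * ~~ odd (i %/ 4) + k < n.
  by have := ltn_ord k; lia.
have nb_inj : injective (fun k => Ordinal (nb k)).
  by move=> k l [] /addnI /val_inj.
rewrite -[X in X <= _](card_ord 4) -(card_imset _ nb_inj).
apply/subset_leq_card/subsetP => _ /imsetP[k _ ->].
change (is_true (adj (K44s n) i (Ordinal (nb k)))).
rewrite adj_K44s /K44_rel iA andbT /=.
have k4 := ltn_ord k; apply/andP; split; lia.
Qed.

Theorem theorem11 :
  (forall n : nat, 8 %| n -> ex_star n (path_graph 4) = 2 * n) /\
  (exists C : nat, forall n : nat,
     ex_star n (path_graph 4) <= 2 * n + C /\
     2 * n <= ex_star n (path_graph 4) + C).
Proof.
have up n : ex_star n (path_graph 4) <= 2 * n.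
  by apply/bigmax_leqP => G /asboolP /edges_le; rewrite card_ord.
have low n : 16 * (n %/ 8) <= ex_star n (path_graph 4).
  apply: leq_trans (edges_K44s n) _.
  by apply: (leq_bigmax_cond (K44s n)); apply/asboolP/K44_rainbow_free.
split=> [n n8|]; first by have := (up n, low n) => -[]; lia.
(* At most 7 vertices fall outside complete blocks, a loss of at most 2 * 7 edges. *)
by exists 14 => n; have := (up n, low n) => -[]; lia.
Qed.
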